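(* Let $x$ be an $N$-periodic trajectory in a billiard, nondegenerate with respect to both periodic and fixed-endpoint variations. Let $x_\Delta(s)$ be a $C^1$ family of configuration-periodic trajectories, parametrized on an open neighborhood of $0$, with $x_\Delta(0)=x$, whose derivative $\delta x_\Delta=\frac{d}{ds}\big|_{s=0}x_\Delta(s)$ is a periodic Jacobi variation with $\delta x_\Delta^1>0$. Let $\phi_\Delta^i(s)$ be the incidence angles with the billiard boundary along the trajectory $x_\Delta(s)$. Then for all sufficiently small $\epsilon>0$, $$C_\Delta(x)=\begin{cases}0,&\text{if }\phi_\Delta^{N+1}(\epsilon)-\phi_\Delta^1(\epsilon)>0,\\ 1,&\text{if }\phi_\Delta^{N+1}(\epsilon)-\phi_\Delta^1(\epsilon)<0.\end{cases}$$
   Context: Billiard setting. $\gamma:S^1\to\mathbb R^2$ is a positively oriented, unit-speed parametrized simple closed $C^2$ curve, the boundary of the billiard table. Put $\ell(u,v)=|\gamma(u)-\gamma(v)|$ and $S=-\ell$. For $N\ge 2$, $\mathcal C^N\subset(S^1)^{N+1}$ is the open set of admissible paths $x=(x^1,\dots,x^{N+1})$: for every $i=1,\dots,N$ one has $x^i\ne x^{i+1}$, and the line segment from $\gamma(x^i)$ to $\gamma(x^{i+1})$ is contained in the table and is never tangent to $\gamma$. Let $L(x)=\sum_{i=1}^N S(x^i,x^{i+1})$. A length-$N$ trajectory is an $x\in\mathcal C^N$ with $\partial_1S(x^i,x^{i+1})+\partial_2S(x^{i-1},x^i)=0$ for $i=2,\dots,N$. It is configuration-periodic if $x^1=x^{N+1}$,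 and $N$-periodic if in addition $\partial_1S(x^1,x^2)+\partial_2S(x^N,x^{N+1})=0$. Angles. Along a length-$N$ trajectory, $\phi^i\in(0,\pi)$ is the angle between $\dot\gamma(x^i)$ and the outgoing direction $\gamma(x^{i+1})-\gamma(x^i)$ for $i\le N$; for $2\le i\le N+1$ the angle $\bar\phi^i\in(0,\pi)$ is the angle between $\dot\gamma(x^i)$ and the incoming direction $\gamma(x^i)-\gamma(x^{i-1})$. The reflection law says $\phi^i=\bar\phi^i$ for $2\le i\le N$, and $\phi^{N+1}:=\bar\phi^{N+1}$. One has $\partial_1S(x^i,x^{i+1})=\cos\phi^i$ and $\partial_2S(x^{i-1},x^i)=-\cos\bar\phi^i$. Index. Identify $T_x\mathcal C^N$ with $\mathbb R^{N+1}$ (entries $\delta x^i$) and let $H_x$ be the symmetric bilinear form with matrix $\big(\partial^2L/\partial x^i\partial x^j(x)\big)$. Let $T_x\mathcal C^N_0=\{\delta x^1=\delta x^{N+1}=0\}$ (fixed-endpoint variations) and $T_x\mathcal C^N_\Delta=\{\delta x^1=\delta x^{N+1}\}$ (periodic variations). The index of a symmetric form is the maximal dimension of a subspace on which it is negative definite. $i_0(x)$, $i_\Delta(x)$ are the indices of $H_x$ restricted to $T_x\mathcal C^N_0$, $T_x\mathcal C^N_\Delta$; $x$ is nondegenerate with respect to the corresponding variations if the restricted form has trivial nullspace. A Jacobi variation is a $\delta x$ with $(H_x\delta x)^i=0$ for $i=2,\dots,N$; it is periodic if $\delta x^1=\delta x^{N+1}$. For $x$ nondegenerate with respect to periodic variations,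 the concavity is $C_\Delta(x)=i_\Delta(x)-i_0(x)$. *)

(* Defs.v *)
From HB Require Import structures.
From mathcomp Require Import all_boot all_order all_algebra.
From mathcomp Require Import all_classical all_reals all_analysis.
Set Implicit Arguments.
Unset Strict Implicit.
Unset Printing Implicit Defensive.
Import Order.TTheory GRing.Theory Num.Theory.
Import numFieldNormedType.Exports.
Local Open Scope classical_set_scope.
Local Open Scope ring_scope.

(** Euclidean geometry of the plane.  The library norm on row vectors is the sup
    norm; it is used below only for the topology and for boundedness. *)

Definition dot (R : realType) (v w : 'rV[R]_2) : R := (v *m w^T) 0 0.

Definition enorm (R : realType) (v : 'rV[R]_2) : R := Num.sqrt (dot v v).

Definition angle (R : realType) (v w : 'rV[R]_2) : R :=
  acos (dot v w / (enorm v * enorm w)).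

(* counterclockwise rotation by a right angle *)
Definition rot90 (R : realType) (v : 'rV[R]_2) : 'rV[R]_2 :=
  \row_(j < 2) (if j == 0 then - v 0 1 else v 0 0).

(** The circle S^1 is R / P Z, P being the perimeter.  Its points are
    represented by real lifts, and functions on it by P-periodic functions. *)

Definition same_point (R : realType) (P u v : R) : Prop :=
  exists k : int, u - v = k%:~R * P.

(* the bounded region(s) cut out by the curve *)
Definition inside (R : realType) (gamma : R -> 'rV[R]_2) : set 'rV[R]_2 :=
  [set p | ~ range gamma p /\
           bounded_set (connected_component (~` range gamma) p)].

Definition table (R : realType) (gamma : R -> 'rV[R]_2) : set 'rV[R]_2 :=
  range gamma `|` inside gamma.

(* [bc_oriented]: positive orientation, i.e. the interior lies to the left. *)
Record billiard_curve (R : realType) (P : R) (gamma : R -> 'rV[R]_2) : Prop := {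
  bc_perimeter : 0 < P;
  bc_closed : forall u, gamma (u + P) = gamma u;
  bc_simple : forall u v, gamma u = gamma v -> same_point P u v;
  bc_derivable : forall u, derivable gamma u 1;
  bc_derivable2 : forall u, derivable (derive1 gamma) u 1;
  bc_C2 : continuous (derive1 (derive1 gamma));
  bc_unit_speed : forall u, enorm (derive1 gamma u) = 1;
  bc_oriented : forall u,
    \forall t \near 0^'+, inside gamma (gamma u + t *: rot90 (derive1 gamma u))
}.

Definition chord (R : realType) (gamma : R -> 'rV[R]_2) (u v : R) : R :=
  enorm (gamma u - gamma v).

Definition genS (R : realType) (gamma : R -> 'rV[R]_2) (u v : R) : R :=
  - chord gamma u v.

Definition d1S (R : realType) (gamma : R -> 'rV[R]_2) (u v : R) : R :=
  derive1 (fun t => genS gamma t v) u.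

Definition d2S (R : realType) (gamma : R -> 'rV[R]_2) (u v : R) : R :=
  derive1 (fun t => genS gamma u t) v.

(** Paths (x^1, ..., x^{N+1}) are row vectors of lifts; [pt x i] is x^{i+1}. *)

Definition pt (R : realType) (N : nat) (x : 'rV[R]_N.+1) (i : nat) : R :=
  x 0 (inord i).

Definition segment_in_table (R : realType) (gamma : R -> 'rV[R]_2)
    (u v : R) : Prop :=
  forall t : R, 0 <= t <= 1 -> table gamma (gamma u + t *: (gamma v - gamma u)).

(* endpoints of the segment included *)
Definition segment_never_tangent (R : realType) (gamma : R -> 'rV[R]_2)
    (u v : R) : Prop :=
  forall t w : R, 0 <= t <= 1 ->
    gamma u + t *: (gamma v - gamma u) = gamma w ->
    ~ exists c : R, gamma v - gamma u = c *: derive1 gamma w.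

Definition admissible (R : realType) (P : R) (gamma : R -> 'rV[R]_2)
    (N : nat) (x : 'rV[R]_N.+1) : Prop :=
  forall i : nat, (i < N)%N ->
    [/\ ~ same_point P (pt x i) (pt x i.+1),
        segment_in_table gamma (pt x i) (pt x i.+1) &
        segment_never_tangent gamma (pt x i) (pt x i.+1)].

Definition lagr (R : realType) (gamma : R -> 'rV[R]_2) (N : nat)
    (x : 'rV[R]_N.+1) : R :=
  \sum_(i < N) genS gamma (pt x i) (pt x i.+1).

Definition trajectory (R : realType) (P : R) (gamma : R -> 'rV[R]_2)
    (N : nat) (x : 'rV[R]_N.+1) : Prop :=
  admissible P gamma x /\
  forall i : nat, (0 < i < N)%N ->
    d1S gamma (pt x i) (pt x i.+1) + d2S gamma (pt x i.-1) (pt x i) = 0.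

Definition configuration_periodic (R : realType) (P : R) (N : nat)
    (x : 'rV[R]_N.+1) : Prop :=
  same_point P (pt x 0) (pt x N).

Definition periodic_trajectory (R : realType) (P : R) (gamma : R -> 'rV[R]_2)
    (N : nat) (x : 'rV[R]_N.+1) : Prop :=
  [/\ trajectory P gamma x, configuration_periodic P x &
      d1S gamma (pt x 0) (pt x 1) + d2S gamma (pt x N.-1) (pt x N) = 0].

Definition angle_out (R : realType) (gamma : R -> 'rV[R]_2) (N : nat)
    (x : 'rV[R]_N.+1) (i : nat) : R :=
  angle (derive1 gamma (pt x i)) (gamma (pt x i.+1) - gamma (pt x i)).

Definition angle_in (R : realType) (gamma : R -> 'rV[R]_2) (N : nat)
    (x : 'rV[R]_N.+1) (i : nat) : R :=
  angle (derive1 gamma (pt x i)) (gamma (pt x i) - gamma (pt x i.-1)).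

(* [phi gamma x i] is phi^{i+1}; the last angle is the incoming one. *)
Definition phi (R : realType) (gamma : R -> 'rV[R]_2) (N : nat)
    (x : 'rV[R]_N.+1) (i : nat) : R :=
  if (i < N)%N then angle_out gamma x i else angle_in gamma x i.

Definition hessian (R : realType) (gamma : R -> 'rV[R]_2) (N : nat)
    (x : 'rV[R]_N.+1) : 'M[R]_N.+1 :=
  \matrix_(i, j)
    'D_(delta_mx 0 i) ('D_(delta_mx 0 j) (@lagr R gamma N)) x.

Definition form (R : realType) (n : nat) (H : 'M[R]_n) (v w : 'rV[R]_n) : R :=
  (v *m H *m w^T) 0 0.

Definition negative_definite_on (R : realType) (n : nat) (H : 'M[R]_n)
    (W : {vspace 'rV[R]_n}) : Prop :=
  forall v, v \in W -> v != 0 -> form H v v < 0.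

(* [V] is meant to be a linear subspace; the maximum is over the dimensions of
   the subspaces [W] of [V] on which [H] is negative definite. *)
Definition index_on (R : realType) (n : nat) (H : 'M[R]_n)
    (V : set 'rV[R]_n) : nat :=
  \max_(k < n.+1 | `[< exists W : {vspace 'rV[R]_n},
      [/\ forall v, v \in W -> V v, \dim W = k & negative_definite_on H W] >]) k.

Definition nondegenerate_on (R : realType) (n : nat) (H : 'M[R]_n)
    (V : set 'rV[R]_n) : Prop :=
  forall v, V v -> (forall w, V w -> form H v w = 0) -> v = 0.

Definition fixed_variations (R : realType) (N : nat) : set 'rV[R]_N.+1 :=
  [set v | v 0 ord0 = 0 /\ v 0 ord_max = 0].

Definition periodic_variations (R : realType) (N : nat) : set 'rV[R]_N.+1 :=
  [set v | v 0 ord0 = v 0 ord_max].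

Definition concavity (R : realType) (gamma : R -> 'rV[R]_2) (N : nat)
    (x : 'rV[R]_N.+1) : int :=
  (index_on (hessian gamma x) (@periodic_variations R N))%:Z -
  (index_on (hessian gamma x) (@fixed_variations R N))%:Z.

Definition jacobi_variation (R : realType) (gamma : R -> 'rV[R]_2) (N : nat)
    (x dx : 'rV[R]_N.+1) : Prop :=
  forall i : 'I_N.+1, (0 < i < N)%N -> (hessian gamma x *m dx^T) i 0 = 0.

Definition C1_on (R : realType) (N : nat) (U : set R)
    (y : R -> 'rV[R]_N.+1) : Prop :=
  forall s, U s -> derivable y s 1 /\ {for s, continuous (derive1 y)}.

(* Main.v *)
(** Let [d] be the derivative of the family at [0].  Being a Jacobi variation, [d]
    is [H_x]-orthogonal to the fixed-endpoint variations, and together with them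
    it spans the periodic variations; hence the concavity is [1] or [0] according
    as [H_x(d, d) < 0] or not.  On the other hand
    [f(s) = cos phi^1(s) - cos phi^(N+1)(s)] vanishes at [0] and
    [f'(0) = (H_x d)^1 + (H_x d)^(N+1) = H_x(d, d) / d^1], which is nonzero since
    [d] is not in the nullspace of the periodic Hessian.  As [cos] is decreasing,
    the sign of [f] for small [s > 0] is that of [phi^(N+1) - phi^1]. *)

Require Import Defs.
From HB Require Import structures.
From mathcomp Require Import all_boot all_order all_algebra.
From mathcomp Require Import all_classical all_reals all_analysis.
From mathcomp Require Import ring.
Set Implicit Arguments.
Unset Strict Implicit.
Unset Printing Implicit Defensive.
Import Order.TTheory GRing.Theory Num.Theory.
Import numFieldNormedType.Exports.
Local Open Scope classical_set_scope.
Local Open Scope ring_scope.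

(* [all_algebra] has its own [form], imported after [Defs]. *)
Local Notation form := Defs.form.

(** * Bilinear forms and their index *)

Lemma formDl (R : realType) n (H : 'M[R]_n) u v w :
  form H (u + v) w = form H u w + form H v w.
Proof. by rewrite /form !mulmxDl mxE. Qed.

Lemma formDr (R : realType) n (H : 'M[R]_n) u v w :
  form H w (u + v) = form H w u + form H w v.
Proof. by rewrite /form linearD mulmxDr mxE. Qed.

Lemma formZl (R : realType) n (H : 'M[R]_n) c v w :
  form H (c *: v) w = c * form H v w.
Proof. by rewrite /form -!scalemxAl mxE. Qed.

Lemma formZr (R : realType) n (H : 'M[R]_n) c v w :
  form H w (c *: v) = c * form H w v.
Proof. by rewrite /form linearZ /= -scalemxAr mxE. Qed.

Lemma formE (R : realType) n (H : 'M[R]_n) v w :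
  form H v w = \sum_i v 0 i * (H *m w^T) i 0.
Proof. by rewrite /form -mulmxA mxE. Qed.

Lemma form_sym (R : realType) n (H : 'M[R]_n) v w :
  H^T = H -> form H v w = form H w v.
Proof.
(* A 1x1 matrix equals its transpose, and transposing reverses the product. *)
move=> Hs; rewrite /form -[LHS](mxE trmx_key (fun i j => (v *m H *m w^T) j i)).
by rewrite -/(trmx _) !trmx_mul trmxK Hs mulmxA.
Qed.

Lemma le_index_on (R : realType) n (H : 'M[R]_n) (V : set 'rV[R]_n)
    (W : {vspace 'rV[R]_n}) :
  (forall v, v \in W -> V v) -> negative_definite_on H W ->
  (\dim W <= index_on H V)%N.
Proof.
(* The maximum ranges over ['I_n.+1], so the dimension has to be bounded by [n] first. *)
move=> WV negW; have dW : (\dim W < n.+1)%N.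
  by rewrite ltnS (leq_trans (dimvS (subvf W)))// dimvf /dim /= mul1n.
rewrite /index_on (bigD1 (Ordinal dW)) /= ?leq_maxl//.
by apply/asboolP; exists W.
Qed.

(** The zero subspace is always a candidate, so the maximum runs over a nonempty set and is not just
    the default value 0. *)
Lemma index_on_attained (R : realType) n (H : 'M[R]_n) (V : set 'rV[R]_n) :
  V 0 -> exists W : {vspace 'rV[R]_n},
    [/\ forall v, v \in W -> V v, \dim W = index_on H V &
        negative_definite_on H W].
Proof.
move=> V0; pose A : pred 'I_n.+1 := fun k => `[< exists W : {vspace 'rV[R]_n},
  [/\ forall v, v \in W -> V v, \dim W = k & negative_definite_on H W] >].
have A0 : A ord0.
  apply/asboolP; exists 0%VS; split; rewrite ?dimv0//.
    by move=> v; rewrite memv0 => /eqP ->.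
  by move=> v; rewrite memv0 => /eqP ->; rewrite eqxx.
have [|k Ak] := @eq_bigmax_cond _ A (fun k : 'I_n.+1 => k : nat).
  by apply/card_gt0P; exists ord0.
have /asboolP[W [WV dW negW]] := Ak.
by move=> e; exists W; split; rewrite ?dW.
Qed.

Section index_orthogonal_line.
Variables (R : realType) (n : nat) (H : 'M[R]_n) (V : {vspace 'rV[R]_n}).
Variables (l : 'Hom('rV[R]_n, R^o)) (d : 'rV[R]_n).
Hypotheses (Hsym : H^T = H) (Vd : d \in V) (ld : l d != 0).
Let V0 : set 'rV[R]_n := [set v | v \in V /\ l v = 0].
Hypothesis dV0 : forall w, V0 w -> form H d w = 0.

Let formDd w c : V0 w ->
  form H (w + c *: d) (w + c *: d) = form H w w + c ^+ 2 * form H d d.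
Proof.
move=> w0; rewrite formDl !formDr !formZl !formZr (form_sym w _ Hsym) dV0//.
by rewrite expr2 !mulr0 addr0 add0r mulrA.
Qed.

Let dn0 : d != 0. Proof. by apply: contra_neq ld => ->; rewrite linear0. Qed.


(** [V] is the [H]-orthogonal sum of [V0] and the line of [d], so the form is diagonal in this
    splitting and the line contributes 1 exactly when [form H d d] is negative. Each inequality
    between dimensions is proved by transforming a maximal negative definite subspace. *)
Lemma index_on_orthogonal_line :
  index_on H [set v | v \in V] = (index_on H V0 + (form H d d < 0)%R)%N.
Proof.
have V00 : V0 0 by split; rewrite ?mem0v ?linear0.
(* The coefficient is chosen so that [l] kills the first summand. *)
have decomp w : w = (w - (l w / l d) *: d) + (l w / l d) *: d by rewrite subrK.
have V0p w : w \in V -> V0 (w - (l w / l d) *: d).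
  move=> Vw; split; first by rewrite memvB// memvZ.
  by rewrite linearB linearZ /= -[_ *: _]/(_ * _) divfK// subrr.
apply/eqP; rewrite eqn_leq; apply/andP; split.
- have [|W [WV <- negW]] := @index_on_attained _ _ H [set v | v \in V].
    exact: mem0v.
  case: ltP => [q_lt0|q_ge0].
    (* Rank-nullity for [l] on [W]: the image lies in a line, so intersecting with the kernel costs
       at most one dimension. *)
    rewrite -(limg_ker_dim l W) leq_add//; last first.
      by rewrite (leq_trans (dimvS (subvf _)))// dimvf.
    apply: le_index_on => v; rewrite memv_cap memv_ker => /andP[Wv /eqP lv0].
      by split => //; exact: WV.
    exact: negW.
  rewrite addn0.
  (* Projection to [V0] along [d]. As [form H d d] is nonnegative here, [pf] does not increase the
     form; hence it is injective on [W] and the image is again negative definite. *)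
  pose pf w := w - (l w / l d) *: d.
  have pfL : linear pf.
    move=> c u v; rewrite /pf linearP /= -[c *: l u]/(c * l u) scalerBr.
    rewrite scalerA mulrDl scalerDl -mulrA opprD; exact: addrACA.
  pose pL : {linear 'rV[R]_n -> 'rV[R]_n} :=
    HB.pack pf (GRing.isLinear.Build _ _ _ _ pf pfL).
  have pE w : linfun pL w = w - (l w / l d) *: d by rewrite lfunE.
  have form_le w : w \in W -> form H (linfun pL w) (linfun pL w) <= form H w w.
    move=> Ww; rewrite pE [in leRHS](decomp w) formDd ?lerDl; last first.
      exact/V0p/WV.
    by rewrite mulr_ge0 ?sqr_ge0.
  rewrite -(@limg_dim_eq _ _ _ (linfun pL)).
    apply: le_index_on => _ /memv_imgP[w Ww ->].
      by rewrite pE; exact/V0p/WV.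
    move=> pw0; rewrite (le_lt_trans (form_le _ Ww))// negW//.
    by apply: contra_neq pw0 => ->; rewrite linear0.
  apply/eqP; rewrite -subv0; apply/subvP => w; rewrite memv_cap memv_ker memv0.
  move=> /andP[Ww /eqP pw0]; apply: contraT => /(negW _ Ww).
  rewrite ltNge (le_trans _ (form_le _ Ww))//.
  by rewrite pw0 /form !mul0mx mxE.
- have [W [WV0 <- negW]] := index_on_attained H V00.
  case: ltP => [q_lt0|_]; last first.
    by rewrite addn0; apply: le_index_on => // v /WV0[].
  (* The sum is direct because [l] vanishes on [W] but not at [d]. *)
  have Wd : \dim (W + <[d]>) = (\dim W + 1)%N.
    rewrite dimv_disjoint_sum ?dim_vline ?dn0//.
    apply/eqP; rewrite -subv0; apply/subvP => w.
    rewrite memv_cap memv0 => /andP[/WV0[_ lw0] /vlineP[c wE]].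
    move: lw0; rewrite wE linearZ /= => /eqP; rewrite -[_ *: _]/(_ * _).
    by rewrite mulf_eq0 (negPf ld) orbF => /eqP ->; rewrite scale0r.
  rewrite -Wd; apply: le_index_on => _ /memv_addP[w Ww [_ /vlineP[c ->] ->]].
    by rewrite /= memvD ?memvZ//; have [] := WV0 _ Ww.
  (* Strict negativity comes from [c ^+ 2 * form H d d] when [w] is zero, and from [form H w w]
     otherwise. *)
  have [->|w_neq0] := eqVneq w 0.
    rewrite add0r => cd0; rewrite formZl formZr mulrA nmulr_llt0//.
    rewrite -expr2 exprn_even_gt0//=.
    by apply: contra_neq cd0 => ->; rewrite scale0r.
  move=> _; rewrite formDd; last exact: WV0.
  by rewrite ltr_wnDr ?negW// mulr_ge0_le0 ?sqr_ge0 ?ltW.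
Qed.

End index_orthogonal_line.

(** * Euclidean geometry of the plane *)

Lemma dotE (R : realType) (v w : 'rV[R]_2) :
  dot v w = v 0 0 * w 0 0 + v 0 1 * w 0 1.
Proof.
rewrite /dot mxE big_ord_recl big_ord1 !mxE.
by have -> : lift ord0 ord0 = 1 :> 'I_2 by exact: val_inj.
Qed.

Lemma dotC (R : realType) (v w : 'rV[R]_2) : dot v w = dot w v.
Proof. by rewrite !dotE mulrC [X in _ + X]mulrC. Qed.

Lemma dotBr (R : realType) (u v w : 'rV[R]_2) :
  dot u (v - w) = dot u v - dot u w.
Proof. by rewrite /dot linearB mulmxBr !mxE. Qed.

Lemma dotZr (R : realType) c (v w : 'rV[R]_2) : dot v (c *: w) = c * dot v w.
Proof. by rewrite /dot linearZ /= -scalemxAr mxE. Qed.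

Lemma dotZl (R : realType) c (v w : 'rV[R]_2) : dot (c *: v) w = c * dot v w.
Proof. by rewrite dotC dotZr dotC. Qed.

Lemma dotNr (R : realType) (v w : 'rV[R]_2) : dot v (- w) = - dot v w.
Proof. by rewrite -scaleN1r dotZr mulN1r. Qed.

Lemma dot_ge0 (R : realType) (v : 'rV[R]_2) : 0 <= dot v v.
Proof. by rewrite dotE -!expr2 addr_ge0 ?sqr_ge0. Qed.

Lemma dot_gt0 (R : realType) (v : 'rV[R]_2) : v != 0 -> 0 < dot v v.
Proof.
move=> v0; rewrite lt_neqAle dot_ge0 andbT eq_sym; apply: contra v0.
rewrite dotE -!expr2 paddr_eq0 ?sqr_ge0// !sqrf_eq0 => /andP[/eqP v0 /eqP v1].
apply/eqP/rowP => j; rewrite mxE.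
by case: j => [[|[|//]]] j2; [rewrite -[RHS]v0 | rewrite -[RHS]v1];
  congr (v _ _); exact: val_inj.
Qed.

Lemma enorm_gt0 (R : realType) (v : 'rV[R]_2) : v != 0 -> 0 < enorm v.
Proof. by move=> v0; rewrite sqrtr_gt0 dot_gt0. Qed.

Lemma enormN (R : realType) (v : 'rV[R]_2) : enorm (- v) = enorm v.
Proof. by rewrite /enorm !dotE !mxE !mulrNN. Qed.

Lemma sqr_enorm (R : realType) (v : 'rV[R]_2) : enorm v ^+ 2 = dot v v.
Proof. by rewrite sqr_sqrtr ?dot_ge0. Qed.

(** Cauchy-Schwarz, obtained from the Lagrange identity in the plane. If a norm vanishes, the
    convention that the inverse of 0 is 0 makes the quotient 0. *)
Lemma dot_enorm_bound (R : realType) (v w : 'rV[R]_2) :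
  -1 <= dot v w / (enorm v * enorm w) <= 1.
Proof.
rewrite -ler_norml normrM normfV.
have nn : 0 <= enorm v * enorm w by rewrite mulr_ge0 ?sqrtr_ge0.
rewrite (ger0_norm nn); have [->|vw0] := eqVneq (enorm v * enorm w) 0.
  by rewrite invr0 mulr0.
rewrite ler_pdivrMr ?lt_neqAle ?nn ?andbT 1?eq_sym// mul1r.
rewrite -(ler_pXn2r (n := 2)) ?nnegrE// real_normK ?num_real//.
rewrite exprMn !sqr_enorm !dotE -subr_ge0.
set a := v 0 0; set b := v 0 1; set c := w 0 0; set e := w 0 1.
suff -> : (a * a + b * b) * (c * c + e * e) - (a * c + b * e) ^+ 2
        = (a * e - b * c) ^+ 2 by exact: sqr_ge0.
ring.
Qed.

(** * Differentiation of vector-valued functions *)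

Lemma is_derive_mxP (R : realType) (V : normedModType R) m n
    (f : V -> 'M[R]_(m, n)) (t v : V) (df : 'M[R]_(m, n)) :
  is_derive t v f df <->
  forall i j, is_derive t v (fun s => f s i j) (df i j).
Proof.
split=> [h i j|h].
  have fd : derivable f t v by case: h.
  apply: DeriveDef; first exact: (derivable_mxP _ _ _).1.
  by have := derive_mx fd; rewrite derive_val => ->; rewrite mxE.
have fd : derivable f t v.
  by apply/derivable_mxP => i j; case: (h i j).
apply: DeriveDef => //; rewrite (derive_mx fd); apply/matrixP => i j.
by rewrite mxE; case: (h i j).
Qed.

Lemma is_derive_comp_row (R : realType) n (f : R -> 'rV[R]_n) (u : R -> R)
    (t du : R) (df : 'rV[R]_n) :
  is_derive (u t) 1 f df -> is_derive t 1 u du ->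
  is_derive t 1 (fun s => f (u s)) (du *: df).
Proof.
move=> /is_derive_mxP hf hu; apply/is_derive_mxP => i j; rewrite mxE mulrC.
exact: (@is_derive1_comp _ (fun s => f s i j) u).
Qed.

Lemma is_derive_dot (R : realType) (V : normedModType R) (f g : V -> 'rV[R]_2)
    (t v : V) df dg :
  is_derive t v f df -> is_derive t v g dg ->
  is_derive t v (fun s => dot (f s) (g s)) (dot df (g t) + dot (f t) dg).
Proof.
move=> /is_derive_mxP hf /is_derive_mxP hg.
have -> : (fun s => dot (f s) (g s)) =
  (fun s => f s 0 0) * (fun s => g s 0 0)
  + (fun s => f s 0 1) * (fun s => g s 0 1).
  by apply/funext => s; rewrite dotE.
apply: (is_derive_eq (is_deriveD (is_deriveM (hf 0 0) (hg 0 0))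
                                 (is_deriveM (hf 0 1) (hg 0 1)))).
rewrite !dotE -![_ *: _]/(_ * _); ring.
Qed.

Lemma is_derive_enorm (R : realType) (w : R -> 'rV[R]_2) (t : R) dw :
  w t != 0 -> is_derive t 1 w dw ->
  is_derive t 1 (fun s => enorm (w s)) (dot (w t) dw / enorm (w t)).
Proof.
move=> w0 hw; have n0 : 0 < dot (w t) (w t) by exact: dot_gt0.
have := is_derive1_comp (is_derive1_sqrt n0) (is_derive_dot hw hw).
move=> h; apply: (is_derive_eq h); rewrite -/(enorm (w t)).
have e0 : enorm (w t) != 0 by rewrite gt_eqF ?enorm_gt0.
by rewrite !dotE; field.
Qed.

Lemma is_derive_dot_enorm (R : realType) (a w : R -> 'rV[R]_2) (t : R) da dw :
  w t != 0 -> is_derive t 1 a da -> is_derive t 1 w dw ->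
  is_derive t 1 (fun s => dot (a s) (w s) / enorm (w s))
    ((dot da (w t) + dot (a t) dw) / enorm (w t)
     - dot (a t) (w t) * dot (w t) dw / enorm (w t) ^+ 3).
Proof.
move=> w0 ha hw; have e0 : enorm (w t) != 0 by rewrite gt_eqF ?enorm_gt0.
have h := is_deriveM (is_derive_dot ha hw) 
  (@is_deriveV _ (fun s => enorm (w s)) _ _ _ e0 (is_derive_enorm w0 hw)).
apply: (is_derive_eq h); rewrite -![_ *: _]/(_ * _).
by field.
Qed.

(** The two difference quotients are the same function of [h]. This reduces directional derivatives
    in path space to one-variable calculus. *)
Lemma is_derive_line (R : realType) (V W : normedModType R) (f : V -> W)
    (a v : V) (df : W) :
  is_derive (0 : R) 1 (fun h : R => f (h *: v + a)) df -> is_derive a v f df.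
Proof.
have E : (fun h : R => h^-1 *: ((f \o shift a) (h *: v) - f a)) =
  (fun h : R => h^-1 *: (((fun h : R => f (h *: v + a)) \o shift 0) (h *: 1)
     - f (0 *: v + a))).
  apply/funext => h /=; rewrite scale0r add0r -[h *: 1]/(h * 1) mulr1 addr0.
  by [].
move=> [h1 h2]; apply: DeriveDef.
  by rewrite /derivable E.
by rewrite /derive E.
Qed.

Lemma is_derive_derive1 (R : realType) (V : normedModType R) (f : R -> V) u :
  derivable f u 1 -> is_derive u 1 f (derive1 f u).
Proof. by move=> fu; rewrite derive1E; exact: DeriveDef. Qed.

(** * Derivatives of the generating function *)

Section generating_function.
Variables (R : realType) (gamma g1 g2 : R -> 'rV[R]_2).
Hypothesis dgamma : forall u : R, is_derive u 1 gamma (g1 u).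
Hypothesis d2gamma : forall u : R, is_derive u 1 g1 (g2 u).

(* Partial derivatives of [genS], with [g1], [g2] in the role of the first two
   derivatives of [gamma]; the mixed one is [genS12]. *)
Definition genS1 (u v : R) : R :=
  - (dot (g1 u) (gamma u - gamma v) / enorm (gamma u - gamma v)).

Definition genS2 (u v : R) : R :=
  dot (g1 v) (gamma u - gamma v) / enorm (gamma u - gamma v).

Definition genS11 (u v : R) : R := let w := gamma u - gamma v in
  dot (g1 u) w ^+ 2 / enorm w ^+ 3
  - (dot (g2 u) w + dot (g1 u) (g1 u)) / enorm w.

Definition genS12 (u v : R) : R := let w := gamma u - gamma v in
  dot (g1 u) (g1 v) / enorm w - dot (g1 u) w * dot (g1 v) w / enorm w ^+ 3.

Definition genS22 (u v : R) : R := let w := gamma u - gamma v in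
  dot (g1 v) w ^+ 2 / enorm w ^+ 3
  + (dot (g2 v) w - dot (g1 v) (g1 v)) / enorm w.

Section along_curves.
Variables (u v : R -> R) (t du dv : R).
Hypotheses (hu : is_derive t 1 u du) (hv : is_derive t 1 v dv).
Hypothesis uv : gamma (u t) != gamma (v t).

Let w_neq0 : gamma (u t) - gamma (v t) != 0. Proof. by rewrite subr_eq0. Qed.

Let e_neq0 : enorm (gamma (u t) - gamma (v t)) != 0.
Proof. by rewrite gt_eqF ?enorm_gt0. Qed.

Let is_derive_gamma (a : R -> R) da : is_derive t 1 a da ->
  is_derive t 1 (fun s => gamma (a s)) (da *: g1 (a t)).
Proof.
by move=> ha; exact: is_derive_comp_row ha.
Qed.

Let is_derive_g1 (a : R -> R) da : is_derive t 1 a da ->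
  is_derive t 1 (fun s => g1 (a s)) (da *: g2 (a t)).
Proof.
by move=> ha; exact: is_derive_comp_row ha.
Qed.

Let is_derive_w : is_derive t 1 (fun s => gamma (u s) - gamma (v s))
  (du *: g1 (u t) - dv *: g1 (v t)).
Proof. exact: is_deriveB (is_derive_gamma hu) (is_derive_gamma hv). Qed.

(** With both endpoints moving along curves, this lemma and the next two cover partial derivatives
    (one endpoint constant), lines in path space and the given family of trajectories. *)
Lemma is_derive_genS : is_derive t 1 (fun s => genS gamma (u s) (v s))
  (genS1 (u t) (v t) * du + genS2 (u t) (v t) * dv).
Proof.
apply: (is_derive_eq (is_deriveN (is_derive_enorm w_neq0 is_derive_w))).
rewrite /genS1 /genS2; cbn beta; move: e_neq0.
move: (gamma _ - gamma _) => w e0; rewrite dotBr !dotZr ![dot w _]dotC.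
by move: (dot _ _) (dot _ _) (enorm w) e0 => a b e e0; field.
Qed.

Lemma is_derive_genS1 : is_derive t 1 (fun s => genS1 (u s) (v s))
  (genS11 (u t) (v t) * du + genS12 (u t) (v t) * dv).
Proof.
apply: (is_derive_eq (is_deriveN
  (is_derive_dot_enorm w_neq0 (is_derive_g1 hu) is_derive_w))).
rewrite /genS11 /genS12; cbn beta zeta; move: e_neq0.
move: (gamma _ - gamma _) => w e0.
rewrite !dotBr !dotZr dotZl ![dot w _]dotC.
move: (enorm w) (dot (g1 _) w) (dot (g2 _) w) (dot (g1 _) w) e0 => e a b c e0.
by move: (dot _ _) (dot _ _) => a1 b1; field.
Qed.

Lemma is_derive_genS2 : is_derive t 1 (fun s => genS2 (u s) (v s))
  (genS12 (u t) (v t) * du + genS22 (u t) (v t) * dv).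
Proof.
apply: (is_derive_eq
  (is_derive_dot_enorm w_neq0 (is_derive_g1 hv) is_derive_w)).
rewrite /genS12 /genS22; cbn beta zeta; move: e_neq0.
move: (gamma _ - gamma _) => w e0.
rewrite !dotBr !dotZr dotZl ![dot w _]dotC [dot (g1 (v t)) (g1 (u t))]dotC.
move: (enorm w) (dot (g1 _) w) (dot (g2 _) w) (dot (g1 _) w) e0 => e a b c e0.
by move: (dot _ _) (dot _ _) => a1 b1; field.
Qed.

End along_curves.

Lemma d1SE u v : gamma u != gamma v -> d1S gamma u v = genS1 u v.
Proof.
move=> uv; rewrite /d1S derive1E.
have h := is_derive_genS (is_derive_id u 1) (is_derive_cst v u 1) uv.
by rewrite (derive_val (is_derive := h)) mulr1 mulr0 addr0.
Qed.

Lemma d2SE u v : gamma u != gamma v -> d2S gamma u v = genS2 u v.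
Proof.
move=> uv; rewrite /d2S derive1E.
have h := is_derive_genS (is_derive_cst u v 1) (is_derive_id v 1) uv.
by rewrite (derive_val (is_derive := h)) mulr1 mulr0 add0r.
Qed.

(** * First and second derivatives of the Lagrangian *)

Section lagrangian.
Variable N : nat.
Implicit Types (y v w : 'rV[R]_N.+1).

Let is_derive_pt_line y v k :
  is_derive (0 : R) 1 (fun h : R => pt (h *: v + y) k) (pt v k).
Proof.
rewrite /pt; have -> : (fun h : R => (h *: v + y) 0 (inord k)) =
    (v 0 (inord k) \*: (id : R -> R)) + cst (y 0 (inord k)).
  by apply/funext => h; rewrite !mxE /= mulrC.
apply: (is_derive_eq (is_deriveD (is_deriveZ _ (is_derive_id (0 : R) 1))
  (is_derive_cst _ _ _))).
by rewrite addr0 -[_ *: _]/(_ * _) mulr1.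
Qed.

Lemma is_derive_lagr y v :
  (forall k, (k < N)%N -> gamma (pt y k) != gamma (pt y k.+1)) ->
  is_derive y v (@lagr R gamma N) (\sum_(k < N)
    (genS1 (pt y k) (pt y k.+1) * pt v k
     + genS2 (pt y k) (pt y k.+1) * pt v k.+1)).
Proof.
move=> yne; apply: is_derive_line; rewrite /lagr.
have y0 k : pt (0 *: v + y) k = pt y k by rewrite scale0r add0r.
pose F (k : 'I_N) (h : R) :=
  genS gamma (pt (h *: v + y) k) (pt (h *: v + y) k.+1).
rewrite (_ : (fun h : R => _) = \sum_(k < N) F k); last first.
  by apply/funext => h; rewrite fct_sumE.
apply: is_derive_sum => k.
have := is_derive_genS (is_derive_pt_line y v k) (is_derive_pt_line y v k.+1).
by rewrite !y0; apply; exact: yne.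
Qed.

(** Finitely many open conditions. A second derivative at [y] needs the formula for the first one on
    a whole neighborhood of [y]. *)
Let near_neq y : (forall k, (k < N)%N -> gamma (pt y k) != gamma (pt y k.+1)) ->
  \forall z \near y, forall k, (k < N)%N -> gamma (pt z k) != gamma (pt z k.+1).
Proof.
move=> yne.
have cg k : {for y, continuous (fun z => gamma (pt z k))}.
  apply: continuous_comp; first exact: coord_continuous.
  by apply/differentiable_continuous/derivable1_diffP; case: (dgamma (pt y k)).
have near_k (k : 'I_N) :
    \forall z \near y, gamma (pt z k) - gamma (pt z k.+1) != 0.
  have yk : gamma (pt y k) - gamma (pt y k.+1) != 0 by rewrite subr_eq0 yne.
  exact: cvgr_neq0 _ (cvgB (cg k) (cg k.+1)) yk.
apply: (@filterS _ _ _ _ _ _ (filter_forall _ near_k)) => z zne k kN.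
by rewrite -subr_eq0; exact: (zne (Ordinal kN)).
Qed.

Lemma derive2_lagr y v w :
  (forall k, (k < N)%N -> gamma (pt y k) != gamma (pt y k.+1)) ->
  'D_w ('D_v (@lagr R gamma N)) y = \sum_(k < N)
    let u1 := pt y k in let u2 := pt y k.+1 in
    ((genS11 u1 u2 * pt w k + genS12 u1 u2 * pt w k.+1) * pt v k
     + (genS12 u1 u2 * pt w k + genS22 u1 u2 * pt w k.+1) * pt v k.+1).
Proof.
move=> yne.
(* The inner derivative is replaced by its explicit formula, valid near [y]. *)
rewrite (@near_eq_derive _ _ _ _ (fun z => \sum_(k < N)
    (genS1 (pt z k) (pt z k.+1) * pt v k
     + genS2 (pt z k) (pt z k.+1) * pt v k.+1))); last first.
  apply: (@filterS _ _ _ _ _ _ (near_neq yne)) => z zne.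
  by have := is_derive_lagr v zne; case.
apply: (@derive_val _ _ _ _ _ _ _ _); apply: is_derive_line.
have y0 k : pt (0 *: w + y) k = pt y k by rewrite scale0r add0r.
pose F (k : 'I_N) (h : R) :=
  genS1 (pt (h *: w + y) k) (pt (h *: w + y) k.+1) * pt v k +
  genS2 (pt (h *: w + y) k) (pt (h *: w + y) k.+1) * pt v k.+1.
rewrite (_ : (fun h : R => _) = \sum_(k < N) F k); last first.
  by apply/funext => h; rewrite fct_sumE.
apply: is_derive_sum => k.
have yk : gamma (pt (0 *: w + y) k) != gamma (pt (0 *: w + y) k.+1).
  by rewrite !y0 yne.
have du1 := is_derive_pt_line y w k; have du2 := is_derive_pt_line y w k.+1.
have h1 := is_derive_genS1 du1 du2 yk; have h2 := is_derive_genS2 du1 du2 yk.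
pose u i (h : R) := pt (h *: w + y) i.
have -> : F k = (pt v k \*: (fun h => genS1 (u k h) (u k.+1 h)))
  + (pt v k.+1 \*: (fun h => genS2 (u k h) (u k.+1 h))).
  by apply/funext => h; rewrite /F /= mulrC [X in _ + X]mulrC.
apply: (is_derive_eq
  (is_deriveD (is_deriveZ (pt v k) h1) (is_deriveZ (pt v k.+1) h2))).
by rewrite !y0 -![_ *: _]/(_ * _) mulrC [X in _ + X]mulrC.
Qed.

(** * Rows of the Hessian *)

Section hessian.
Variable y : 'rV[R]_N.+1.
Hypothesis yne : forall k, (k < N)%N -> gamma (pt y k) != gamma (pt y k.+1).

Let hessianE i j : hessian gamma y i j = \sum_(k < N)
  let u1 := pt y k in let u2 := pt y k.+1 in
  let ei := delta_mx 0 i : 'rV[R]_N.+1 in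
  let ej := delta_mx 0 j : 'rV[R]_N.+1 in
    ((genS11 u1 u2 * pt ei k + genS12 u1 u2 * pt ei k.+1) * pt ej k
     + (genS12 u1 u2 * pt ei k + genS22 u1 u2 * pt ei k.+1) * pt ej k.+1).
Proof. by rewrite [LHS]mxE; exact: derive2_lagr. Qed.

Lemma hessian_sym : (hessian gamma y)^T = hessian gamma y.
Proof.
apply/matrixP => i j; rewrite mxE !hessianE.
by apply: eq_bigr => k _; cbv zeta; ring.
Qed.

Let sum_pt_delta v k : \sum_j pt (delta_mx 0 j) k * v 0 j = pt v k.
Proof.
rewrite (bigD1 (inord k))//= big1 ?addr0 => [|j jk].
  by rewrite /pt mxE !eqxx mul1r.
by rewrite /pt mxE eq_sym (negPf jk) andbF mul0r.
Qed.

Lemma hessian_mul v i : (hessian gamma y *m v^T) i 0 = \sum_(k < N)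
  let u1 := pt y k in let u2 := pt y k.+1 in
  let e := delta_mx 0 i : 'rV[R]_N.+1 in
    (pt e k * (genS11 u1 u2 * pt v k + genS12 u1 u2 * pt v k.+1)
     + pt e k.+1 * (genS12 u1 u2 * pt v k + genS22 u1 u2 * pt v k.+1)).
Proof.
rewrite mxE; under eq_bigr => j _ do rewrite hessianE mxE mulr_suml.
rewrite exchange_big /=; apply: eq_bigr => k _.
(* Expanding the entries of [v] over the standard basis makes both sides sums over the same [j], to
   be compared term by term. *)
rewrite -[in RHS](sum_pt_delta v k) -[in RHS](sum_pt_delta v k.+1).
rewrite !mulr_sumr -!big_split /= !mulr_sumr -big_split /=.
by apply: eq_bigr => j _; cbv zeta; ring.
Qed.

Hypothesis N_gt0 : (0 < N)%N.

(** The first vertex belongs to segment 0 only, as its left end. *)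
Lemma hessian_mul_first v : (hessian gamma y *m v^T) ord0 0 =
  genS11 (pt y 0) (pt y 1) * pt v 0 + genS12 (pt y 0) (pt y 1) * pt v 1.
Proof.
rewrite hessian_mul (bigD1 (Ordinal N_gt0))//= big1 ?addr0 => [|k k0].
  rewrite /pt !mxE !eqxx /= -!val_eqE /= !inordK//= ?ltnS//.
  by rewrite mul1r mul0r addr0.
rewrite /pt !mxE !eqxx /= -!val_eqE /= !inordK ?ltnS//; last exact: ltnW.
by rewrite -val_eqE /= in k0; rewrite (negPf k0) !mul0r addr0.
Qed.

(** The last vertex belongs to segment [N.-1] only, as its right end. *)
Lemma hessian_mul_last v : (hessian gamma y *m v^T) ord_max 0 =
  genS12 (pt y N.-1) (pt y N) * pt v N.-1
  + genS22 (pt y N.-1) (pt y N) * pt v N.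
Proof.
have NN : (N.-1 < N)%N by rewrite prednK.
rewrite hessian_mul (bigD1 (Ordinal NN))//= big1 ?addr0 => [|k k0].
  rewrite !prednK// /pt !mxE !eqxx /= -!val_eqE /= !inordK ?ltnS ?leq_pred//.
  by rewrite eqxx ltn_eqF// mul1r mul0r add0r.
rewrite /pt !mxE !eqxx /= -!val_eqE /= !inordK ?ltnS//; last exact: ltnW.
rewrite -val_eqE /= in k0; rewrite ltn_eqF//.
have -> : (k.+1 == N) = false.
  by apply: contraNF k0 => /eqP kN; rewrite -(succnK k) kN.
by rewrite !mul0r addr0.
Qed.

End hessian.

End lagrangian.
End generating_function.

(** * One-sided signs and incidence angles *)

(** As [f 0 = 0], the difference quotient is [f e / e]; it tends to [k] from the right, so it is
    eventually positive. *)
Lemma is_derive_right_gt0 (R : realType) (f : R -> R) (k : R) :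
  is_derive (0 : R) 1 f k -> f 0 = 0 -> 0 < k -> \forall e \near 0^'+, 0 < f e.
Proof.
move=> [fd fk] f0 k_gt0; rewrite -fk in k_gt0.
have /cvg_dnbhs_at_right fcvg :
    h^-1 *: ((f \o shift 0) (h *: 1) - f 0) @[h --> 0^'] --> 'D_1 f 0.
  exact: fd.
have quot_gt0 := cvgr_gt _ fcvg _ k_gt0.
near=> e; have e_gt0 : 0 < e by near: e; exact: nbhs_right_gt.
have : 0 < e^-1 *: ((f \o shift 0) (e *: 1) - f 0) by near: e; exact: quot_gt0.
rewrite /= f0 subr0 addr0 -![_ *: _]/(_ * _) mulr1.
by rewrite pmulr_rgt0 ?invr_gt0.
Unshelve. all: by end_near.
Qed.

Lemma ltr_acos (R : realType) (a b : R) : -1 <= a <= 1 -> -1 <= b <= 1 ->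
  (acos a < acos b) = (b < a).
Proof.
move=> a1 b1; have [/andP[a0 api] aK] := acos_def a1.
have [/andP[b0 bpi] bK] := acos_def b1.
by rewrite -[in RHS]aK -[in RHS]bK ltr_cos// in_itv /= ?a0 ?b0.
Qed.

Section angles.
Variables (R : realType) (gamma : R -> 'rV[R]_2).
Hypothesis unit_speed : forall u, enorm (derive1 gamma u) = 1.
Local Notation g1 := (derive1 gamma).

Lemma genS1_bound u v : -1 <= genS1 gamma g1 u v <= 1.
Proof.
have := dot_enorm_bound (g1 u) (gamma u - gamma v).
by rewrite unit_speed mul1r -!ler_norml normrN.
Qed.

Lemma NgenS2_bound u v : -1 <= - genS2 gamma g1 u v <= 1.
Proof.
have := dot_enorm_bound (g1 v) (gamma u - gamma v).
by rewrite unit_speed mul1r -!ler_norml normrN.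
Qed.

Variables (N : nat) (y : 'rV[R]_N.+1).
Hypothesis N_gt0 : (0 < N)%N.

(** The vector in [genS1] and [genS2] points against the direction of travel. Hence [genS1] is the
    cosine of the outgoing angle, and [genS2] is minus that of the incoming one. *)
Lemma phi_first : phi gamma y 0 = acos (genS1 gamma g1 (pt y 0) (pt y 1)).
Proof.
rewrite /phi N_gt0 /angle_out /angle unit_speed mul1r /genS1.
by rewrite -mulNr -dotNr opprB -enormN opprB.
Qed.

Lemma phi_last : phi gamma y N = acos (- genS2 gamma g1 (pt y N.-1) (pt y N)).
Proof.
rewrite /phi ltnn /angle_in /angle unit_speed mul1r /genS2.
by rewrite -mulNr -dotNr opprB -enormN opprB.
Qed.

Lemma phi_first_lt_last : (phi gamma y 0 < phi gamma y N) =
  (0 < genS1 gamma g1 (pt y 0) (pt y 1) + genS2 gamma g1 (pt y N.-1) (pt y N)).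
Proof.
rewrite phi_first phi_last (ltr_acos (genS1_bound _ _) (NgenS2_bound _ _)).
by rewrite -subr_gt0 opprK.
Qed.

Lemma phi_last_lt_first : (phi gamma y N < phi gamma y 0) =
  (genS1 gamma g1 (pt y 0) (pt y 1) + genS2 gamma g1 (pt y N.-1) (pt y N) < 0).
Proof.
rewrite phi_first phi_last (ltr_acos (NgenS2_bound _ _) (genS1_bound _ _)).
by rewrite -subr_lt0 opprK.
Qed.

End angles.

(** * Jacobi variations and the concavity *)

(** The interior entries of the Hessian applied to [d] vanish by the Jacobi equation, so only the
    two ends pair with [w]. *)
Lemma form_jacobi (R : realType) (gamma : R -> 'rV[R]_2) N
    (x d w : 'rV[R]_N.+1) :
  (0 < N)%N -> jacobi_variation gamma x d ->
  form (hessian gamma x) w d =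
    w 0 ord0 * (hessian gamma x *m d^T) ord0 0
    + w 0 ord_max * (hessian gamma x *m d^T) ord_max 0.
Proof.
move=> N_gt0 dJ; rewrite formE (bigD1 ord0)//= (bigD1 ord_max)//=; last first.
  by rewrite -val_eqE /= -lt0n.
rewrite big1 ?addr0// => i /andP[i0 iN]; rewrite dJ ?mulr0//.
rewrite lt0n; rewrite -!val_eqE /= in i0 iN; rewrite i0 /=.
by rewrite ltn_neqAle iN -ltnS ltn_ord.
Qed.

(** Instance of [index_on_orthogonal_line]: the periodic variations are the kernel of [gap], and
    inside it the fixed-endpoint ones are the kernel of the first coordinate. *)
Lemma index_periodic (R : realType) N (H : 'M[R]_N.+1) (d : 'rV[R]_N.+1) :
  H^T = H -> periodic_variations d -> d 0 ord0 != 0 ->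
  (forall w, fixed_variations w -> form H d w = 0) ->
  index_on H (@periodic_variations R N) =
    (index_on H (@fixed_variations R N) + (form H d d < 0)%R)%N.
Proof.
move=> Hsym dP d0 dF.
have gapL : linear ((fun w => w 0 ord0 - w 0 ord_max) : 'rV[R]_N.+1 -> R^o).
  by move=> c u v; rewrite !mxE -[c *: _]/(_ * _); ring.
have fstL : linear ((fun w => w 0 ord0) : 'rV[R]_N.+1 -> R^o).
  by move=> c u v; rewrite !mxE.
pose gap : {linear 'rV[R]_N.+1 -> R^o} :=
  HB.pack (fun w : 'rV[R]_N.+1 => w 0 ord0 - w 0 ord_max : R^o)
    (GRing.isLinear.Build _ _ _ _ _ gapL).
pose fst : {linear 'rV[R]_N.+1 -> R^o} :=
  HB.pack (fun w : 'rV[R]_N.+1 => w 0 ord0 : R^o)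
    (GRing.isLinear.Build _ _ _ _ _ fstL).
have memP w : (w \in lker (linfun gap)) = (w 0 ord0 == w 0 ord_max).
  by rewrite memv_ker lfunE /= subr_eq0.
have fstE w : linfun fst w = w 0 ord0 by rewrite lfunE.
have PE : @periodic_variations R N = [set v | v \in lker (linfun gap)].
  by apply/seteqP; split=> w; rewrite /= memP => /eqP.
have FE : @fixed_variations R N =
    [set v | v \in lker (linfun gap) /\ linfun fst v = 0].
  apply/seteqP; split=> w; rewrite /= memP fstE.
    by move=> [-> ->].
  by move=> [/eqP e0 w0]; split; rewrite -?e0.
rewrite PE FE; apply: index_on_orthogonal_line => //.
- by rewrite memP dP.
- by rewrite fstE.
- by move=> w; rewrite -[X in X -> _]/([set v | _] w) -FE; exact: dF.
Qed.

Theorem proposition2p13 (R : realType) (P : R) (gamma : R -> 'rV[R]_2)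
  (Hgamma : billiard_curve P gamma)
  (N : nat) (hN : (2 <= N)%N)
  (x : 'rV[R]_N.+1) (hx : periodic_trajectory P gamma x)
  (hndP : nondegenerate_on (hessian gamma x) (@periodic_variations R N))
  (hnd0 : nondegenerate_on (hessian gamma x) (@fixed_variations R N))
  (U : set R) (hU : open U) (hU0 : U 0)
  (xD : R -> 'rV[R]_N.+1) (hC1 : C1_on U xD)
  (htraj : forall s, U s ->
     trajectory P gamma (xD s) /\ configuration_periodic P (xD s))
  (hxD0 : xD 0 = x)
  (hJacobi : jacobi_variation gamma x (derive1 xD 0))
  (hper : periodic_variations (derive1 xD 0))
  (hpos : 0 < derive1 xD 0 0 ord0) :
  \forall e \near (0 : R)^'+,
    let dphi := phi gamma (xD e) N - phi gamma (xD e) 0 in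
    [/\ dphi != 0,
        0 < dphi -> concavity gamma x = 0 &
        dphi < 0 -> concavity gamma x = 1].
Proof.
have N_gt0 : (0 < N)%N by exact: ltnW.
have dgamma (u : R) : is_derive u 1 gamma (derive1 gamma u).
  exact: is_derive_derive1 (@bc_derivable _ _ _ Hgamma u).
have d2gamma (u : R) :
    is_derive u 1 (derive1 gamma) (derive1 (derive1 gamma) u).
  exact: is_derive_derive1 (@bc_derivable2 _ _ _ Hgamma u).
have [[xadm _] _ xper] := hx.
have xne k : (k < N)%N -> gamma (pt x k) != gamma (pt x k.+1).
  by move=> /xadm[xk _ _]; apply/eqP => /(bc_simple Hgamma).
have xneN : gamma (pt x N.-1) != gamma (pt x N).
  by have := xne N.-1; rewrite prednK//; apply.
set d := derive1 xD 0 in hJacobi hper hpos.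
have dxD k : is_derive (0 : R) 1 (fun s => pt (xD s) k) (pt d k).
  have [xD' _] := hC1 _ hU0.
  by have /is_derive_mxP := is_derive_derive1 xD'; exact.
pose H := hessian gamma x.
pose kappa := (H *m d^T) ord0 0 + (H *m d^T) ord_max 0.
pose f s := genS1 gamma (derive1 gamma) (pt (xD s) 0) (pt (xD s) 1)
  + genS2 gamma (derive1 gamma) (pt (xD s) N.-1) (pt (xD s) N).
(* This is the reflection law at the closing vertex of the periodic trajectory. *)
have f0 : f 0 = 0.
  rewrite /f hxD0 -(d1SE dgamma (xne 0%N N_gt0)) -(d2SE dgamma xneN).
  exact: xper.
have df : is_derive (0 : R) 1 f kappa.
  (* The two end entries of [H *m d^T] are the derivatives at 0 of the two summands of [f]. *)
  rewrite /kappa (hessian_mul_first dgamma d2gamma xne N_gt0).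
  rewrite (hessian_mul_last dgamma d2gamma xne N_gt0) -hxD0.
  apply: is_deriveD.
    by apply: (is_derive_genS1 dgamma d2gamma); rewrite ?hxD0//; exact: xne.
  by apply: (is_derive_genS2 dgamma d2gamma); rewrite ?hxD0.
have Hsym : H^T = H by exact (hessian_sym dgamma d2gamma xne).
have Hd w : periodic_variations w -> form H w d = w 0 ord0 * kappa.
  by move=> wP; rewrite (form_jacobi w N_gt0 hJacobi) -wP mulrDr.
have kappa_neq0 : kappa != 0.
  (* With [kappa = 0], [d] would be in the nullspace of the periodic form, hence zero, against
     [hpos]. *)
  apply: contraTneq hpos => kappa0; suff -> : d = 0 by rewrite mxE ltxx.
  by apply: hndP hper _ => w wP; rewrite (form_sym _ _ Hsym) Hd// kappa0 mulr0.
(* [form H d d] is [kappa] times the positive first entry of [d], so both have the same sign. *)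
have concE : concavity gamma x = (kappa < 0)%R%:Z.
  rewrite /concavity -/H (index_periodic Hsym hper).
  - by rewrite Hd// pmulr_rlt0// PoszD addrAC subrr add0r.
  - by rewrite gt_eqF.
  - move=> w [w0 wN]; rewrite (form_sym _ _ Hsym) Hd ?w0 ?mul0r//.
    by rewrite /periodic_variations /= w0 wN.
have phi_lt := phi_first_lt_last (bc_unit_speed Hgamma) _ N_gt0.
have phi_gt := phi_last_lt_first (bc_unit_speed Hgamma) _ N_gt0.
have [k0|k0|/eqP] := ltgtP kappa 0; last by rewrite (negPf kappa_neq0).
(* For negative [kappa] the one-sided criterion is applied to [- f]. *)
- have dNf : is_derive (0 : R) 1 (- f) (- kappa) by exact: is_deriveN.
  have Nf_gt0 : \forall e \near 0^'+, 0 < (- f) e.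
    apply: is_derive_right_gt0 dNf _ _; last by rewrite oppr_gt0.
    by rewrite -[LHS]/(- f 0) f0 oppr0.
  near=> e; have fe_lt0 : f e < 0 by rewrite -oppr_gt0; near: e.
  have dphi_lt0 : phi gamma (xD e) N - phi gamma (xD e) 0 < 0.
    by rewrite subr_lt0 phi_gt.
  split; first by rewrite lt_eqF.
    by rewrite ltNge ltW.
  by rewrite concE k0.
- have f_gt0 := is_derive_right_gt0 df f0 k0.
  near=> e; have fe_gt0 : 0 < f e by near: e.
  have dphi_gt0 : 0 < phi gamma (xD e) N - phi gamma (xD e) 0.
    by rewrite subr_gt0 phi_lt.
  split; first by rewrite gt_eqF.
    by rewrite concE (lt_gtF k0).
  by rewrite ltNge ltW.
Unshelve. all: by end_near.
Qed.
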